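(* Suppose that in an instance $I$ on the real line with preferred distances bounded by $B$ there are $r$ agents with locations in the range $[\mathrm{med}-B,\mathrm{med}+B]$, where $\mathrm{med}$ is the median of the agent locations, and suppose the average of the values $b_i$ over these agents is $\overline{b}$. Then the Median-Plus mechanism achieves social cost at most $OPT(I)+2r\overline{b}$.
   Context: An instance with $n\ge1$ agents is $I=\langle (x_1,b_1),\dots,(x_n,b_n)\rangle$, with locations $x_i\in\mathbb{R}$ and preferred distances $b_i\in[0,B]$. The cost of agent $i$ for facility location $y\in\mathbb{R}$ is $cost(y,(x_i,b_i))=|x_i-b_i-y|$ if $y\le x_i$ and $|x_i+b_i-y|$ if $y>x_i$ (equivalently $\big||x_i-y|-b_i\big|$); the social cost is $SC(y,I)=\sum_i cost(y,(x_i,b_i))$ and $OPT(I)=\min_{y\in\mathbb{R}}SC(y,I)$. The median of $n$ items is the item of rank $\lfloor (n+1)/2\rfloor$ in increasing order, ties among equal agent locations being resolved by a fixed ordering of the agents; $\mathrm{med}$ is the median of $x_1,\dots,x_n$. Median-Plus mechanism: for each agent $i$, set $p_i=x_i+b_i$ if $x_i\le\mathrm{med}$ and $p_i=x_i-b_i$ otherwise (for agents with $x_i=\mathrm{med}$ the comparison is resolved by the fixed ordering: $p_i=x_i+b_i$ exactly for agents of rank at most $\lfloor (n+1)/2\rfloor$). Output the median of $p_1,\dots,p_n$ as the facility location. *)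

(* Defs.v *)
From mathcomp Require Import all_boot all_order all_algebra fingroup perm.
From mathcomp Require Import all_classical all_reals all_analysis.

Set Implicit Arguments.
Unset Strict Implicit.
Unset Printing Implicit Defensive.

Import Order.TTheory GRing.Theory Num.Theory.
Import numFieldNormedType.Exports.

Local Open Scope ring_scope.

(** An instance is the tuple of the pairs (location, preferred distance). *)
Definition instance (R : realType) (n : nat) : Type := n.-tuple (R * R).

Definition loc (R : realType) n (I : instance R n) (i : 'I_n) : R :=
  (tnth I i).1.

Definition dist (R : realType) n (I : instance R n) (i : 'I_n) : R :=
  (tnth I i).2.

Definition dist_in_range (R : realType) n (B : R) (I : instance R n) : Prop :=
  forall i : 'I_n, 0 <= dist I i <= B.

Definition cost (R : realType) (y : R) (a : R * R) : R :=
  if y <= a.1 then `|a.1 - a.2 - y| else `|a.1 + a.2 - y|.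

Definition SC (R : realType) n (y : R) (I : instance R n) : R :=
  \sum_(i < n) cost y (tnth I i).

(** [OPT] is written as an infimum; by [OPT_min] below it is the minimum of
    the social cost as soon as there is at least one agent. *)
Definition OPT (R : realType) n (I : instance R n) : R :=
  inf (range (fun y : R => SC y I)).

(** Ranks are counted from 1. *)
Definition median_rank (n : nat) : nat := (n.+1)./2.

(** [nth] counts from 0, hence the predecessor. *)
Definition median (R : realType) (s : seq R) : R :=
  nth 0 (sort <=%R s) (median_rank (size s)).-1.

Definition med (R : realType) n (I : instance R n) : R :=
  median [seq loc I i | i <- enum 'I_n].

(** The fixed ordering of the agents is an arbitrary permutation [tie]: among
    agents with the same location, [j] comes before [i] if
    [tie j < tie i]. *)
Definition weakly_before (R : realType) n (tie : 'S_n) (I : instance R n)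
    (j i : 'I_n) : bool :=
  (loc I j < loc I i) || ((loc I j == loc I i) && (tie j <= tie i)%N).

Definition agent_rank (R : realType) n (tie : 'S_n) (I : instance R n)
    (i : 'I_n) : nat :=
  #|[pred j | weakly_before tie I j i]|.

Definition plus_point (R : realType) n (tie : 'S_n) (I : instance R n)
    (i : 'I_n) : R :=
  if (loc I i < med I)
     || ((loc I i == med I) && (agent_rank tie I i <= median_rank n)%N)
  then loc I i + dist I i
  else loc I i - dist I i.

Definition median_plus (R : realType) n (tie : 'S_n) (I : instance R n) : R :=
  median [seq plus_point tie I i | i <- enum 'I_n].

Definition near_med (R : realType) n (B : R) (I : instance R n) : pred 'I_n :=
  [pred i | med I - B <= loc I i <= med I + B].

Lemma costE (R : realType) (y : R) (a : R * R) :
  cost y a = `| `|a.1 - y| - a.2 |.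
Proof.
rewrite /cost; case: leP => yx.
  by rewrite [`|a.1 - y|]ger0_norm ?subr_ge0// addrAC.
rewrite [`|a.1 - y|]ltr0_norm ?subr_lt0// -normrN; congr (`| _ |).
by rewrite !opprD !opprK addrAC.
Qed.

Lemma cost_ge0 (R : realType) (y : R) (a : R * R) : 0 <= cost y a.
Proof. by rewrite costE. Qed.

Lemma SC_continuous (R : realType) n (I : instance R n) :
  continuous (fun y : R => SC y I).
Proof.
rewrite /SC; apply: continuous_big => [|i _ y].
  exact: add_continuous.
under eq_fun do rewrite costE.
apply: (@cvg_norm R R^o); apply: cvgB; last exact: cvg_cst.
apply: (@cvg_norm R R^o); apply: cvgB; [exact: cvg_cst|exact: cvg_id].
Qed.

Lemma OPT_min (R : realType) n (I : instance R n) : (0 < n)%N ->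
  (exists y : R, SC y I = OPT I) /\ (forall y : R, OPT I <= SC y I).
Proof.
case: n I => // n I _.
set a := tnth I ord0.
set K := SC 0 I + `|a.1| + `|a.2|.
have SC0 : 0 <= SC 0 I by apply: sumr_ge0 => i _; exact: cost_ge0.
have K0 : 0 <= K by rewrite /K !addr_ge0.
have KK : - K <= K by rewrite (le_trans _ K0)// oppr_le0.
have [c _ cmin] := EVT_min KK (continuous_subspaceT (@SC_continuous _ _ I)).
have cglob y : SC c I <= SC y I.
  have [yK|yK] := leP `|y| K.
    by apply: cmin; rewrite in_itv/= -ler_norml.
  apply: (@le_trans _ _ (SC 0 I)).
    by apply: cmin; rewrite in_itv/= K0 oppr_le0 K0.
  apply: (@le_trans _ _ (cost y a)).
    rewrite costE; apply: le_trans (ler_norm _).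
    have h1 : `|y| - `|a.1| <= `|a.1 - y| by rewrite distrC lerB_dist.
    rewrite lerBrDr; apply: le_trans h1.
    rewrite lerBrDr; apply: le_trans (ltW yK).
    by rewrite /K addrAC lerD2l ler_norm.
  rewrite /SC big_ord_recl lerDl.
  by apply: sumr_ge0 => i _; exact: cost_ge0.
have lb : lbound (range (fun y : R => SC y I)) (SC c I).
  by move=> _ [y _ <-].
have OPTc : OPT I = SC c I.
  apply/eqP; rewrite eq_le; apply/andP; split.
    by apply: ge_inf; [exists (SC c I)|exists c].
  by apply: lb_le_inf => //; exists (SC c I), c.
by rewrite OPTc; split; first by exists c.
Qed.

(* Main.v *)
Require Import Defs.
From mathcomp Require Import all_boot all_order all_algebra fingroup perm.
From mathcomp Require Import all_classical all_reals all_analysis.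
From mathcomp Require Import lra zify.

(** Let [G y] be the sum of the [|p_i - y|].  Since the cost of an agent is
    its distance to the nearer of [x_i - b_i] and [x_i + b_i], [SC <= G]
    everywhere, and the mechanism outputs a minimizer of [G].  Conversely,
    clamping a facility location into [med - B, med + B] does not increase
    [SC], because at least half of the agents benefit from the move at full
    rate.  At a clamped location [y], every agent with [|x_i - med| > B] has
    cost exactly [|p_i - y|], while any other agent has
    [|p_i - y| <= cost + 2 b_i]. *)

Set Implicit Arguments.
Unset Strict Implicit.
Unset Printing Implicit Defensive.

Import Order.TTheory GRing.Theory Num.Theory.
Local Open Scope ring_scope.

(** Passing from [g] to [f] gains at least [d] on each index of [P] and loses at most [d] elsewhere;
    as [P] covers at least half of the indices, the gains pay for the losses. *)
Lemma ler_sum_majority (R : realType) n (f g : 'I_n -> R) (P : pred 'I_n)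
    (d : R) : 0 <= d -> (n <= 2 * #|P|)%N ->
  (forall i, P i -> f i + d <= g i) -> (forall i, f i <= g i + d) ->
  \sum_i f i <= \sum_i g i.
Proof.
move=> d0 nP fgP fg.
have : \sum_i (f i + (if P i then d + d else 0)) <= \sum_i (g i + d).
  apply: ler_sum => i _; case: ifP => Pi; last by rewrite addr0.
  by rewrite addrA lerD2r fgP.
rewrite !big_split/= -big_mkcond/= !sumr_const card_ord.
have : d *+ n <= (d + d) *+ #|P|.
  by rewrite -mulr2n -mulrnA ler_wpMn2l.
set s := \sum_i f i; set t := \sum_i g i.
set u := d *+ n; set v := (d + d) *+ _ => uv st.
lra.
Qed.

Section median.
Variables (R : realType) (n : nat) (F : 'I_n -> R).
Hypothesis n_gt0 : (0 < n)%N.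

Local Notation s := [seq F i | i <- enum 'I_n].

Let size_s : size (sort <=%R s) = n.
Proof. by rewrite size_sort size_map size_enum_ord. Qed.

Let card_count (p : pred R) : #|[pred i | p (F i)]| = count p (sort <=%R s).
Proof.
rewrite count_sort count_map.
by rewrite cardE size_filter enumT.
Qed.

Let rank_lt : ((median_rank n).-1 < n)%N.
Proof. by rewrite /median_rank; lia. Qed.

Let median_nth : median s = nth 0 (sort <=%R s) (median_rank n).-1.
Proof. by rewrite /median size_map size_enum_ord. Qed.

Let sort_nth_le i j : (i <= j < n)%N ->
  nth 0 (sort <=%R s) i <= nth 0 (sort <=%R s) j.
Proof.
move=> /andP[ij jn].
apply: (sorted_leq_nth le_trans le_refl); rewrite ?inE ?size_s//.
  exact: sort_le_sorted.
exact: leq_ltn_trans jn.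
Qed.

(** The first [median_rank n] sorted values qualify, and twice the floor of (n + 1) / 2 is at least
    n. *)
Lemma card_le_median : (n <= 2 * #|[pred i | (F i <= median s)%R]|)%N.
Proof.
rewrite (card_count (fun x => x <= median s)).
rewrite -(cat_take_drop (median_rank n) (sort <=%R s)) count_cat.
have : all (fun x => x <= median s) (take (median_rank n) (sort <=%R s)).
  apply/(all_nthP 0) => i; rewrite size_take_min size_s => ilt.
  rewrite nth_take; last by lia.
  by rewrite median_nth sort_nth_le//; lia.
rewrite all_count => /eqP ->; rewrite size_take_min size_s.
by rewrite /median_rank; lia.
Qed.

(** Here the sorted values from index [(median_rank n).-1] on qualify, the median itself
    included. *)
Lemma card_ge_median : (n <= 2 * #|[pred i | (median s <= F i)%R]|)%N.
Proof.
rewrite (card_count (fun x => median s <= x)).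
rewrite -(cat_take_drop (median_rank n).-1 (sort <=%R s)) count_cat.
have : all (fun x => median s <= x) (drop (median_rank n).-1 (sort <=%R s)).
  apply/(all_nthP 0) => i; rewrite size_drop size_s => ilt.
  by rewrite nth_drop median_nth sort_nth_le//; lia.
rewrite all_count => /eqP ->; rewrite size_drop size_s.
by rewrite /median_rank; lia.
Qed.

(** Moving from [y] to the median shortens the distance to every point at or beyond the median by
    the full length of the move, and these points are a majority in the sense of
    [ler_sum_majority]. *)
Lemma median_minimizes y :
  \sum_i `|F i - median s| <= \sum_i `|F i - y|.
Proof.
have dist_le i : `|F i - median s| <= `|F i - y| + `|y - median s|.
  exact: ler_distD.
have [ym|my] := leP y (median s).
  apply: (ler_sum_majority (normr_ge0 _) card_ge_median _ dist_le).
  move=> i /= mF; rewrite (@ler0_norm _ (y - _)) ?subr_le0//.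
  by rewrite !ger0_norm; lra.
apply: (ler_sum_majority (normr_ge0 _) card_le_median _ dist_le).
move=> i /= Fm; rewrite (@ger0_norm _ (y - _)) ?subr_ge0 ?(ltW my)//.
by rewrite !ler0_norm; lra.
Qed.

End median.

Lemma cost_lipschitz (R : realType) (a : R * R) (y z : R) :
  cost z a <= cost y a + `|y - z|.
Proof.
rewrite !costE [leRHS]addrC; apply: (le_trans (ler_distD `|a.1 - y| _ _)).
rewrite lerD2r; apply: le_trans (ler_dist_dist _ _) _.
by rewrite opprB addrC addrA subrK.
Qed.

(** Reverse triangle inequality for [a.1 - y] and [- a.2]. *)
Lemma cost_le_right (R : realType) (a : R * R) (y : R) :
  0 <= a.2 -> cost y a <= `|a.1 + a.2 - y|.
Proof.
move=> b0; rewrite costE -[X in _ - X](ger0_norm b0) -(normrN a.2).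
by apply: le_trans (ler_dist_dist _ _) _; rewrite opprK addrAC.
Qed.

Lemma cost_le_left (R : realType) (a : R * R) (y : R) :
  0 <= a.2 -> cost y a <= `|a.1 - a.2 - y|.
Proof.
move=> b0; rewrite costE -[X in _ - X](ger0_norm b0).
by apply: le_trans (ler_dist_dist _ _) _; rewrite addrAC.
Qed.

(** The distance from [a.1] to [y] exceeds the cost by at most [a.2], and the shift by [c] adds at
    most [a.2] more. It is meant for [c] equal to plus or minus [a.2]. *)
Lemma dist_le_cost (R : realType) (a : R * R) (y c : R) :
  `|c| <= a.2 -> `|a.1 + c - y| <= cost y a + 2 * a.2.
Proof.
move=> cb; rewrite costE addrAC.
have := ler_normD (a.1 - y) c; have := ler_norm (`|a.1 - y| - a.2).
lra.
Qed.

Section instance.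
Variables (R : realType) (n : nat) (tie : 'S_n) (B : R) (I : instance R n).
Hypothesis n_gt0 : (0 < n)%N.
Hypothesis b_range : dist_in_range B I.

Let dist_ge0 i : 0 <= dist I i. Proof. by have /andP[] := b_range i. Qed.

Let dist_le i : dist I i <= B. Proof. by have /andP[] := b_range i. Qed.

Let B_ge0 : 0 <= B.
Proof. exact: le_trans (dist_ge0 (Ordinal n_gt0)) (dist_le _). Qed.

(** An agent with [loc I i <= med I] has its right peak [loc I i + dist I i] at or below
    [med I + B], so its cost drops by the whole length of the move; any other cost grows by at most
    that length. *)
Lemma SC_clamp_right y : med I + B <= y -> SC (med I + B) I <= SC y I.
Proof.
move=> mBy; have d0 : 0 <= y - (med I + B) by rewrite subr_ge0.
apply: (ler_sum_majority d0 (card_le_median (loc I) n_gt0)).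
  move=> i; rewrite /= -/(med I) => xm.
  have := dist_le i; have := dist_ge0 i; rewrite /dist !costE.
  rewrite /loc in xm; move: (med I) xm mBy {d0} => m xm mBy b0 bB.
  rewrite ![`|(_ : R * R).1 - _|]ler0_norm; [|lra..].
  by rewrite !ger0_norm; lra.
by move=> i; rewrite -(ger0_norm d0) cost_lipschitz.
Qed.

Lemma SC_clamp_left y : y <= med I - B -> SC (med I - B) I <= SC y I.
Proof.
move=> ymB; have d0 : 0 <= med I - B - y by rewrite subr_ge0.
apply: (ler_sum_majority d0 (card_ge_median (loc I) n_gt0)).
  move=> i; rewrite /= -/(med I) => mx.
  have := dist_le i; have := dist_ge0 i; rewrite /dist !costE.
  rewrite /loc in mx; move: (med I) mx ymB {d0} => m mx ymB b0 bB.
  rewrite ![`|(_ : R * R).1 - _|]ger0_norm; [|lra..].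
  by rewrite !ger0_norm; lra.
by move=> i; rewrite -(ger0_norm d0) distrC cost_lipschitz.
Qed.

Lemma SC_clamp y :
  exists2 z, med I - B <= z <= med I + B & SC z I <= SC y I.
Proof.
have [yl|ly] := leP y (med I - B).
  exists (med I - B); last exact: SC_clamp_left.
  by rewrite lexx/=; have := B_ge0; lra.
have [ry|yr] := leP (med I + B) y.
  exists (med I + B); last exact: SC_clamp_right.
  by rewrite lexx andbT; have := B_ge0; lra.
by exists y; rewrite ?(ltW ly) ?(ltW yr).
Qed.

Lemma cost_le_plus_point y i :
  cost y (tnth I i) <= `|plus_point tie I i - y|.
Proof.
rewrite /plus_point; case: ifP => _.
  exact/cost_le_right/dist_ge0.
exact/cost_le_left/dist_ge0.
Qed.

Lemma plus_point_le_cost y i : med I - B <= y <= med I + B ->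
  `|plus_point tie I i - y| <=
  cost y (tnth I i) + (if near_med B I i then 2 * dist I i else 0).
Proof.
move=> /andP[ly yr]; case: ifPn => [_|].
  rewrite /plus_point; case: ifP => _; apply: dist_le_cost;
    by rewrite ?normrN ger0_norm// dist_ge0.
rewrite addr0 /= negb_and -!ltNge /plus_point /cost -!/(loc I i) -!/(dist I i).
have B0 := B_ge0.
(* A far agent lies strictly on one side of both [med I] and [y], so [plus_point] and [cost] select
   the same peak: the right one for an agent on the left, the left one for an agent on the right. *)
case/orP => far.
  have -> : loc I i < med I by lra.
  by have /lt_geF -> : loc I i < y by lra.
have mx : med I < loc I i by lra.
rewrite (lt_gtF mx) (gt_eqF mx)/=.
by have -> : y <= loc I i by lra.
Qed.

(** With [z] the clamped [y], the chain runs from [SC] to [G] at the output, then to [G z], to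
    [SC z] plus the error of the near agents, and finally to [SC y]. *)
Lemma median_plus_SC_le y :
  SC (median_plus tie I) I <=
  SC y I + 2 * \sum_(i < n | near_med B I i) dist I i.
Proof.
have [z zmed zy] := SC_clamp y.
apply: (@le_trans _ _ (\sum_i `|plus_point tie I i - median_plus tie I|)).
  by apply: ler_sum => i _; exact: cost_le_plus_point.
apply: (le_trans (median_minimizes (plus_point tie I) n_gt0 z)).
apply: le_trans.
  by apply: ler_sum => i _; exact: plus_point_le_cost zmed.
rewrite big_split/= -big_mkcond/= mulr_sumr lerD2r.
exact: zy.
Qed.

End instance.

Theorem corollary1 (R : realType) (n : nat) (tie : 'S_n) (B : R)
    (I : instance R n) (r : nat) (bbar : R)
    (n_gt0 : (0 < n)%N)
    (b_range : dist_in_range B I)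
    (r_def : #|near_med B I| = r)
    (bbar_def : bbar = (\sum_(i < n | near_med B I i) dist I i) / r%:R) :
  SC (median_plus tie I) I <= OPT I + 2 * r%:R * bbar.
Proof.
(* The optimum is attained, so the bound is applied at a minimizer [y]. *)
have [[y <-] _] := OPT_min I n_gt0.
suff -> : 2 * r%:R * bbar = 2 * \sum_(i < n | near_med B I i) dist I i.
  exact: median_plus_SC_le.
rewrite -mulrA; congr (2 * _); rewrite bbar_def.
(* With [r = 0] the average is the junk value [0 / 0 = 0]. *)
have [r0|r_neq0] := eqVneq r 0%N; last by rewrite mulrC divfK ?pnatr_eq0.
rewrite r0 mul0r big_pred0// => i.
by move/card0_eq: (etrans r_def r0) => /(_ i).
Qed.
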